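(* Let $X$ be a Banach space with summable Szlenk index. Then $X^*$ has property $\mathcal{Q}$.
   Context: Szlenk derivation: for a weak$^*$ compact $K\subset X^*$ and $\varepsilon>0$, $s_\varepsilon(K)=K\setminus\bigcup\{V\subset X^*: V\text{ weak}^*\text{ open and }\mathrm{diam}(V\cap K)<\varepsilon\}$. A Banach space $X$ has summable Szlenk index if there is $c>0$ such that for all $n\in\mathbb{N}$ and all $\varepsilon_1,\dots,\varepsilon_n>0$, the condition $s_{\varepsilon_n}(s_{\varepsilon_{n-1}}(\dots s_{\varepsilon_1}(B_{X^*})\dots))\ne\emptyset$ implies $\varepsilon_1+\dots+\varepsilon_n\le c$. Interlaced graphs: $\mathbb{N}=\{1,2,\dots\}$. For $k\in\mathbb{N}$ and infinite $\mathbb{M}\subset\mathbb{N}$, $[\mathbb{M}]^k$ is the set of $k$-element subsets of $\mathbb{M}$, written as strictly increasing $k$-tuples. Two distinct $\overline n,\overline m\in[\mathbb{N}]^k$ are adjacent iff $n_1\le m_1\le n_2\le\dots\le n_k\le m_k$ or $m_1\le n_1\le m_2\le\dots\le m_k\le n_k$; $d_{\mathbb{K}}$ is the shortest path metric of this graph. Property $\mathcal{Q}$: a Banach space $Z$ has property $\mathcal{Q}$ if there is $C\ge1$ such that for every $k\in\mathbb{N}$ and every Lipschitz map $f:([\mathbb{N}]^k,d_{\mathbb{K}})\to Z$ there is an infinite $\mathbb{M}\subset\mathbb{N}$ with $\|f(\overline n)-f(\overline m)\|\le C\,\omega_f(1)$ for all $\overline n,\overline m\in[\mathbb{M}]^k$,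 where $\omega_f(1)=\sup\{\|f(\overline n)-f(\overline m)\|: d_{\mathbb{K}}(\overline n,\overline m)\le1\}$. *)

(* Defs.v *)
From HB Require Import structures.
From mathcomp Require Import all_boot all_order all_algebra.
From mathcomp Require Import all_classical all_reals all_analysis.
From mathcomp Require Import lra.

Set Implicit Arguments.
Unset Strict Implicit.
Unset Printing Implicit Defensive.

Import Order.TTheory GRing.Theory Num.Theory.
Import numFieldNormedType.Exports.

Local Open Scope classical_set_scope.
Local Open Scope ring_scope.

Section Dual.
Context {R : realType}.
Variable X : normedModType R.

Definition dual_pred : {pred (X -> R^o)} :=
  fun f => `[< linear f /\ continuous f >].

Lemma dual_predP (f : X -> R^o) :
  reflect (linear f /\ continuous f) (f \in dual_pred).
Proof. exact: asboolP. Qed.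

Lemma dual_submod_closed : submod_closed dual_pred.
Proof.
split=> [|a f g /dual_predP[lf cf] /dual_predP[lg cg]]; apply/dual_predP.
  split; last exact: cst_continuous.
  move=> a x y; rewrite -[LHS]/(0 : R^o) -[RHS]/(a *: 0 + 0 : R^o).
  by rewrite scaler0 addr0.
split=> [b x y|x].
  rewrite -[LHS]/(a *: f (b *: x + y) + g (b *: x + y)).
  rewrite -[RHS]/(b *: (a *: f x + g x) + (a *: f y + g y)).
  by rewrite lf lg !scalerDr !scalerA (mulrC a) addrACA.
apply: continuousD; last exact: cg.
by apply: continuousZr; exact: cf.
Qed.

HB.instance Definition _ :=
  GRing.isSubmodClosed.Build R (X -> R^o) dual_pred dual_submod_closed.

Record dual := Dual { dual_fun :> X -> R^o; _ : dual_fun \in dual_pred }.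

HB.instance Definition _ := [isSub for dual_fun].
HB.instance Definition _ := [Choice of dual by <:].
HB.instance Definition _ := [SubChoice_isSubLmodule of dual by <:].

Definition dual_norm (f : dual) : R :=
  sup [set `|f x| | x in [set x : X | `|x| <= 1]].

Lemma dual_linear (f : dual) : linear f.
Proof. by case: f => f /= /dual_predP[]. Qed.

Lemma dual_continuous (f : dual) : continuous f.
Proof. by case: f => f /= /dual_predP[]. Qed.

Lemma dual_linear0 (f : dual) : f 0 = 0.
Proof. by have := dual_linear f (-1) 0 0; rewrite scaler0 add0r scaleN1r addNr. Qed.

Lemma dual_linearZ (f : dual) a x : f (a *: x) = a * f x.
Proof. by have := dual_linear f a x 0; rewrite dual_linear0 !addr0. Qed.

Let pack_linear (f : X -> R^o) (lf : linear f) : {linear X -> R^o} :=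
  HB.pack f (GRing.isLinear.Build _ _ _ _ _ lf).

Lemma dual_bounded (f : dual) :
  has_sup [set `|f x| | x in [set x : X | `|x| <= 1]].
Proof.
split; first by exists `|f 0|, 0 => //=; rewrite normr0.
have : bounded_near (pack_linear (dual_linear f)) (nbhs (0 : X)).
  by apply/linear_bounded_continuous; exact: dual_continuous.
move/linear_boundedP/pinfty_ex_gt0 => [M M0 fM].
exists M => _ [x /= x1 <-]; apply: le_trans (fM x) _.
by rewrite -[leRHS]mulr1 ler_wpM2l// ltW.
Qed.

Lemma dual_norm_ge0 (f : dual) : 0 <= dual_norm f.
Proof.
apply: le_trans (normr_ge0 (f 0)) _.
by apply: (sup_upper_bound (dual_bounded f)); exists 0 => //=; rewrite normr0.
Qed.

Lemma dual_norm_le (f : dual) x : `|f x| <= dual_norm f * `|x|.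
Proof.
have [->|x0] := eqVneq x 0; first by rewrite dual_linear0 !normr0 mulr0.
have nx : 0 < `|x| by rewrite normr_gt0.
rewrite -ler_pdivrMr//.
apply: (sup_upper_bound (dual_bounded f)); exists (`|x|^-1 *: x) => /=.
  by rewrite normrZ normfV normr_id mulVf ?gt_eqF.
by rewrite dual_linearZ normrM normfV normr_id mulrC.
Qed.

Lemma dual_normP (f : dual) (M : R) :
  0 <= M -> (forall x, `|f x| <= M * `|x|) -> dual_norm f <= M.
Proof.
move=> M0 fM; apply: ge_sup; first by case: (dual_bounded f).
move=> _ [x /= x1 <-]; apply: le_trans (fM x) _.
by rewrite -[leRHS]mulr1 ler_wpM2l.
Qed.

Lemma dual_normD (f g : dual) : dual_norm (f + g) <= dual_norm f + dual_norm g.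
Proof.
apply: dual_normP => [|x]; first by rewrite addr_ge0 ?dual_norm_ge0.
by rewrite mulrDl (le_trans (ler_normD _ _))// lerD ?dual_norm_le.
Qed.

Lemma dual_normZ (a : R) (f : dual) : dual_norm (a *: f) = `|a| * dual_norm f.
Proof.
have le b g : dual_norm (b *: g) <= `|b| * dual_norm g.
  apply: dual_normP => [|x]; first by rewrite mulr_ge0 ?dual_norm_ge0.
  by rewrite normrM -mulrA ler_wpM2l ?dual_norm_le.
apply/eqP; rewrite eq_le le/=.
have [->|a0] := eqVneq a 0; first by rewrite normr0 mul0r dual_norm_ge0.
rewrite -ler_pdivlMl ?normr_gt0// -normfV (le_trans _ (le _ _))//.
by rewrite scalerA mulVf// scale1r.
Qed.

Lemma dual_norm0_eq0 (f : dual) : dual_norm f = 0 -> f = 0.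
Proof.
move=> f0; apply/val_inj/funext => x; apply/eqP.
by rewrite -normr_le0 (le_trans (dual_norm_le f x))// f0 mul0r.
Qed.

HB.instance Definition _ :=
  Lmodule_isNormed.Build R dual dual_normD dual_normZ dual_norm0_eq0.

Lemma dual_normE (f : dual) :
  `|f| = sup [set `|f x| | x in [set x : X | `|x| <= 1]].
Proof. by []. Qed.

Lemma dual_complete (F : set_system dual) : ProperFilter F -> cauchy F -> cvg F.
Proof.
move=> FF /cauchyP Fc.
have near_eval (e : R) (f0 : dual) : F (ball f0 e) ->
    forall x, F [set f : dual | `|f0 x - f x| <= e * `|x|].
  move=> Ff0 x; apply: filterS Ff0 => f; rewrite -ball_normE /= => /ltW f0f.
  apply: le_trans (dual_norm_le (f0 - f) x) _.
  by rewrite ler_wpM2r.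
have ev_cvg x : cvg ((fun f : dual => f x : R^o) @ F).
  apply/cauchy_cvgP/cauchy_exP => e e0.
  have d0 : 0 < e / (`|x| + 1) by rewrite divr_gt0// ltr_wpDl.
  have [f0 Ff0] := Fc _ d0.
  exists (f0 x); near=> f; rewrite -ball_normE /=.
  apply: (@le_lt_trans _ _ (e / (`|x| + 1) * `|x|)).
    by near: f; exact: near_eval.
  by rewrite mulrAC ltr_pdivrMr ?ltr_pM2l ?ltrDl// ltr_wpDl.
pose l x : R^o := lim ((fun f : dual => f x : R^o) @ F).
have l_cvg x : (fun f : dual => f x : R^o) @ F --> l x := ev_cvg x.
have ll : linear l.
  move=> a x y; apply: (cvg_unique _ (l_cvg (a *: x + y))) => //.
  have -> : (fun f : dual => f (a *: x + y)) = (fun f => a *: f x + f y).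
    by apply/funext => f; exact: dual_linear.
  by apply: cvgD; [apply: cvgZr|]; exact: l_cvg.
have l_near (e : R) (f0 : dual) : F (ball f0 e) ->
    forall x, `|f0 x - l x| <= e * `|x|.
  move=> Ff0 x.
  have /cvg_norm cl : (fun f : dual => f0 x - f x : R^o) @ F --> f0 x - l x.
    by apply: cvgB; [exact: cvg_cst|exact: l_cvg].
  by apply: (cvgr_to_le cl); exact: near_eval.
have lc : continuous l.
  have [f0 Ff0] := Fc 1 ltr01.
  apply: (@bounded_linear_continuous R X R^o (pack_linear ll)).
  apply/linear_boundedP; near=> r => x /=.
  have -> : l x = f0 x - (f0 x - l x) by rewrite opprB addrC subrK.
  apply: le_trans (ler_normB _ _) _.
  apply: le_trans (lerD (dual_norm_le f0 x) (l_near _ _ Ff0 x)) _.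
  by rewrite -mulrDl ler_wpM2r.
have lP : l \in dual_pred by apply/dual_predP.
apply/cvg_ex; exists (Dual lP); apply/cvgrPdist_lt => e e0.
have e3 : 0 < e / 3 by rewrite divr_gt0.
have [f0 Ff0] := Fc _ e3.
apply: filterS (Ff0) => f; rewrite -ball_normE /= => f0f.
have lf0 : `|f0 - Dual lP| <= e / 3.
  by apply: dual_normP; [exact: ltW|exact: l_near].
rewrite distrC -(subrKA f0) (le_lt_trans (ler_normD _ _))//.
rewrite distrC (lt_le_trans (ltr_leD f0f lf0))// -mulrDr.
lra.
Unshelve. all: by end_near. Qed.

HB.instance Definition _ := Uniform_isComplete.Build dual dual_complete.

End Dual.

Section Szlenk.
Context {R : realType}.
Variable X : normedModType R.

(* The topology carried by [dual X] itself is the norm topology; [weak_star]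
   is the same type with the topology of pointwise convergence on X. *)
Definition weak_star :=
  initial_topology (@dual_fun R X : dual X -> {ptws X -> R^o}).

(* The diameter of the empty set comes out as -oo rather than 0; it is only
   ever compared with a positive number. *)
Definition diameter (A : set (dual X)) : \bar R :=
  ereal_sup [set (`|p.1 - p.2|)%:E | p in A `*` A].

Definition szlenk_derivation (e : R) (K : set (dual X)) : set (dual X) :=
  K `\` \bigcup_(V in [set V : set (dual X) |
      open (V : set weak_star) /\ (diameter (V `&` K) < e%:E)%E]) V.

Definition dual_ball : set (dual X) := [set f | `|f| <= 1].

(* The fold applies the derivation of parameter [tnth e ord0] first. *)
Definition summable_szlenk_index :=
  exists2 c : R, 0 < c &
    forall (n : nat) (e : n.-tuple R), (0 < n)%N ->
      (forall i, 0 < tnth e i) ->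
      foldl (fun K a => szlenk_derivation a K) dual_ball e !=set0 ->
      \sum_(i < n) tnth e i <= c.

End Szlenk.

Section InterlacedGraph.
Variable k : nat.

(* The library's nat contains 0; the vertices are built on {1, 2, ...}. *)
Definition ksubset :=
  {t : k.-tuple nat | sorted ltn t && all (leq 1) t}.

Definition ksubset_nth (n : ksubset) (i : 'I_k) : nat := tnth (val n) i.
Coercion ksubset_nth : ksubset >-> Funclass.

Definition ksubsets_of (M : set nat) : set ksubset :=
  [set n | forall i, M (n i)].

(* n_1 <= m_1 <= n_2 <= ... <= n_k <= m_k *)
Definition interlaced (n m : ksubset) : bool :=
  [forall i, n i <= m i]%N &&
  [forall i : 'I_k, forall j : 'I_k, (j == i.+1 :> nat) ==> (m i <= n j)%N].

Definition interlaced_adjacent : rel ksubset :=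
  fun n m => (n != m) && (interlaced n m || interlaced m n).

Definition joined_by_path (n m : ksubset) (l : nat) : Prop :=
  exists p : seq ksubset, [/\ path interlaced_adjacent n p, last n p = m & size p = l].

Let joined n m := exists l, joined_by_path n m l.

Let joined_refl n : joined n n.
Proof. by exists 0%N, [::]. Qed.

Let joined_trans n m q : joined n m -> joined m q -> joined n q.
Proof.
move=> [_ [p [np pm _]]] [_ [r [mr rq _]]].
exists (size (p ++ r)), (p ++ r).
by rewrite cat_path last_cat np pm mr.
Qed.

Let interlaced_joined n m : interlaced n m -> joined n m /\ joined m n.
Proof.
move=> nm; have [->|n_m] := eqVneq n m; first by split; exact: joined_refl.
split; [exists 1%N, [:: m]|exists 1%N, [:: n]]; split=> //=.
  by rewrite /interlaced_adjacent n_m nm.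
by rewrite /interlaced_adjacent eq_sym n_m nm orbT.
Qed.

Lemma ksubset_mono (n : ksubset) (i j : 'I_k) : (i < j)%N -> (n i < n j)%N.
Proof.
have /andP[st _] := valP n => ij; rewrite /ksubset_nth /= !(tnth_nth 0%N).
by rewrite (sorted_ltn_nth ltn_trans)// inE size_tuple.
Qed.

Lemma ksubset_gt0 (n : ksubset) (i : 'I_k) : (0 < n i)%N.
Proof. by have /andP[_ /all_tnthP] := valP n; exact. Qed.

Let ksubset_ex (g : 'I_k -> nat) :
    (forall i j : 'I_k, (i < j)%N -> (g i < g j)%N) ->
    (forall i, (0 < g i)%N) ->
  exists n : ksubset, forall i, n i = g i.
Proof.
move=> gmono g0.
have gP : sorted ltn (mktuple g) && all (leq 1) (mktuple g).
  apply/andP; split; last by apply/all_tnthP => i; rewrite tnth_mktuple.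
  apply/(sortedP 0%N) => i; rewrite size_tuple => ik.
  have ik' : (i < k)%N by apply: ltn_trans ik.
  rewrite -(tnth_nth 0%N _ (Ordinal ik)) -(tnth_nth 0%N _ (Ordinal ik')).
  by rewrite !tnth_mktuple; exact: gmono.
by exists (Sub (mktuple g) gP : ksubset) => i; rewrite /ksubset_nth /= tnth_mktuple.
Qed.

Lemma ksubset_inj (n m : ksubset) : n =1 m -> n = m.
Proof. by move=> nm; apply/val_inj/eq_from_tnth. Qed.

Let le_joined (n m : ksubset) : (forall i, n i <= m i)%N -> joined n m /\ joined m n.
Proof.
move=> nm.
suff H j : exists2 t : ksubset,
    (forall i : 'I_k, t i = if (i < j)%N then n i else m i) &
    joined t m /\ joined m t.
  have [t tE] := H k; suff -> : t = n by [].
  by apply: ksubset_inj => i; rewrite tE ltn_ord.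
elim: j => [|j [t tE [tm mt]]].
  by exists m => //; split; exact: joined_refl.
have [||u uE] := @ksubset_ex (fun i => if (i < j.+1)%N then n i else m i).
- move=> a b ab; case: (ltnP a j.+1) => aj; case: (ltnP b j.+1) => bj.
  + exact: ksubset_mono.
  + exact: leq_trans (ksubset_mono n ab) (nm b).
  + by have := leq_trans (leq_ltn_trans aj ab) (ltnW bj); rewrite ltnn.
  + exact: ksubset_mono.
- by move=> i; case: ifP => _; exact: ksubset_gt0.
exists u => //.
have /interlaced_joined[ut tu] : interlaced u t.
  apply/andP; split; apply/forallP => i.
    rewrite uE tE ltnS; case: ltngtP => // _; exact: nm.
  apply/forallP => a; apply/implyP => /eqP ai.
  rewrite uE tE ai ltnS; case: (ltnP i j) => ij.
    by apply/ltnW/ksubset_mono; rewrite ai.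
  by apply/ltnW/ksubset_mono; rewrite ai.
by split; [exact: joined_trans ut tm|exact: joined_trans mt tu].
Qed.

Lemma interlaced_connected n m : exists l, `[< joined_by_path n m l >].
Proof.
suff [l nml] : joined n m by exists l; exact/asboolP.
have [||u uE] := @ksubset_ex (fun i => maxn (n i) (m i)).
- move=> i j ij; rewrite gtn_max !leq_max.
  by rewrite !(ksubset_mono _ ij) orbT.
- by move=> i; rewrite leq_max ksubset_gt0.
have [nu _] : joined n u /\ joined u n.
  by apply: le_joined => i; rewrite uE leq_maxl.
have [_ um] : joined m u /\ joined u m.
  by apply: le_joined => i; rewrite uE leq_maxr.
exact: joined_trans nu um.
Qed.

Definition interlaced_dist (n m : ksubset) : nat :=
  ex_minn (interlaced_connected n m).

End InterlacedGraph.

Section PropertyQ.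
Context {R : realType}.

Definition interlaced_lipschitz (Z : normedModType R) k (f : ksubset k -> Z) :=
  exists L : R, forall n m, `|f n - f m| <= L * (interlaced_dist n m)%:R.

Definition modulus (Z : normedModType R) k (f : ksubset k -> Z) (t : R) :
    \bar R :=
  ereal_sup [set (`|f p.1 - f p.2|)%:E | p in
    [set p : ksubset k * ksubset k | (interlaced_dist p.1 p.2)%:R <= t]].

Definition property_Q (Z : completeNormedModType R) :=
  exists2 C : R, 1 <= C &
    forall (k : nat) (f : ksubset k -> Z), (0 < k)%N ->
      interlaced_lipschitz f ->
      exists M : set nat,
        [/\ infinite_set M, M `<=` [set i | (0 < i)%N] &
            forall n m : ksubset k, ksubsets_of M n -> ksubsets_of M m ->
              ((`|f n - f m|)%:E <= C%:E * modulus f 1)%E].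

End PropertyQ.

(* Main.v *)
From HB Require Import structures.
Require Import Defs.
From mathcomp Require Import all_boot all_order all_algebra.
From mathcomp Require Import all_classical all_reals all_analysis.
From mathcomp Require Import ring lra.

(** Why the theorem holds.  Rescale [f] so that adjacent vertices have images at
distance at most 1, and fix a free ultrafilter [U] on the integers.  Taking
weak-star limits along [U] in the last variable, then in the one before it,
and so on, gives maps [iterlim r] of [k - r] variables, ending with a single
functional [iterlim k [::]].  If [s] and [t] are interlaced, then so are their
extensions by a large [n] and a still larger [m]; since the norm is weak-star
lower semicontinuous, each [iterlim r] is again 1-Lipschitz for interlaced
arguments ([lipschitz_levelP]).  This bound is also what makes the limits
exist.

The distance from [f n] to [iterlim k [::]] is at most the sum of the [k]
jumps between consecutive limits.  Along the iterated ultrafilter the jump of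
level [r] converges to a number, of which [a r] is half.  Consider now the
differences [iterlim r s - iterlim r t] with [s] and [t] interlaced: for
[r = 0] they lie in the unit ball.  Letting first the last entry of [t] and
then the last entry of [s] tend to infinity, the second passage to the limit
is one in which points stay at distance at least [a r] from their weak-star
limit; such a limit survives a Szlenk derivation of parameter [a r]
([szlenk_jump]).  After [k] steps the point 0 lies in the iterated derived set
of the ball ([iterlim_szlenk_levels]), so summability bounds the sum of the
[a r] by [c], hence the sum of the jumps by about [2 c].  It is essential that
the ball has radius 1 here, and not the diameter of the range of [f]: this is
what the differences over interlaced pairs are for.

This gives the estimate for most [n] in the sense of the iterated
ultrafilter; a diagonal extraction ([homogeneous_subset]) turns it into an
estimate on all increasing tuples of an infinite set.  An ultrafilter is used
rather than subsequences because [X] need not be separable. *)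

Set Implicit Arguments.
Unset Strict Implicit.
Unset Printing Implicit Defensive.

Import Order.TTheory GRing.Theory Num.Theory.
Import numFieldNormedType.Exports.

Local Open Scope classical_set_scope.
Local Open Scope ring_scope.

(** * Limits along ultrafilters and Szlenk derivations *)

Lemma ultra_of_setVsetC T (F : set_system T) : ProperFilter F ->
  (forall A, F A \/ F (~` A)) -> UltraFilter F.
Proof.
move=> FF FVC; split=> // G GF FG; apply/seteqP; split => // A GA.
have [//|/FG GnA] := FVC A.
by have [x []] := filter_ex (filterI GA GnA).
Qed.

(** The image of the ultrafilter has a cluster point in the compact interval
from [- M] to [M], and a cluster point of an ultrafilter is a limit. *)
Lemma bounded_ultra_cvg (R : realType) T (F : set_system T) (f : T -> R) (M : R) :
  UltraFilter F -> (\forall t \near F, `|f t| <= M) ->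
  exists l : R, f t @[t --> F] --> l.
Proof.
move=> UF fM.
have cM := @segment_compact R (- M) M.
have [|l [_ cl]] := cM (f @ F) _.
  by near=> t; rewrite /= in_itv /= -ler_norml; near: t.
exists l => B lB; have [//|FnB] := in_ultra_setVsetC (f @^-1` B) UF.
by have [x []] := cl (~` B) B FnB lB.
Unshelve. all: by end_near. Qed.

Section WeakStarLimits.
Context {R : realType} {X : normedModType R}.
Implicit Types (l v : dual X) (K : set (dual X)).

(** Convergence is tested pointwise, which avoids the topology of [weak_star]
everywhere except in [wcvg_open]. *)
Definition wcvg T (F : set_system T) (u : T -> dual X) l :=
  forall x, (u t x : R^o) @[t --> F] --> (l x : R^o).

Lemma wcvg_open T (F : set_system T) (u : T -> dual X) l (V : set (dual X)) :
  Filter F -> wcvg F u l -> open (V : set (weak_star X)) -> V l ->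
  \forall t \near F, V (u t).
Proof.
move=> FF ul [A oA <-] Al.
have c : {ptws, (fun t => dual_fun (u t)) @ F --> dual_fun l}.
  by apply/pointwise_cvgP => x; exact: ul.
by apply: (c A); apply: open_nbhs_nbhs; split.
Qed.

(** Weak-star lower semicontinuity of the norm. *)
Lemma wcvg_norm_le T (F : set_system T) (u : T -> dual X) l v (M : R) :
  ProperFilter F -> wcvg F u l -> (\forall t \near F, `|u t - v| <= M) ->
  `|l - v| <= M.
Proof.
move=> FF ul uM; have [t0 t0M] := filter_ex uM.
apply: dual_normP => [|x]; first exact: le_trans t0M.
have c : `|u t x - v x| @[t --> F] --> `|l x - v x|.
  by apply: cvg_norm; apply: cvgB; [exact: ul|exact: cvg_cst].
apply: (cvgr_to_le c); apply: filterS uM => t utM.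
by apply: le_trans (dual_norm_le (u t - v) x) _; rewrite ler_wpM2r.
Qed.

Lemma wcvgB T (F : set_system T) (u : T -> dual X) l v :
  Filter F -> wcvg F u l -> wcvg F (fun t => u t - v) (l - v).
Proof. by move=> FF ul x; apply: cvgB; [exact: ul|exact: cvg_cst]. Qed.

Lemma wcvgBr T (F : set_system T) (u : T -> dual X) l v :
  Filter F -> wcvg F u l -> wcvg F (fun t => v - u t) (v - l).
Proof. by move=> FF ul x; apply: cvgB; [exact: cvg_cst|exact: ul]. Qed.

(** The form of the Banach-Alaoglu theorem needed here: the pointwise limits
along the ultrafilter are linear, and inherit the bound [M]. *)
Lemma bounded_ultra_wcvg T (F : set_system T) (u : T -> dual X) (M : R) :
  UltraFilter F -> (\forall t \near F, `|u t| <= M) -> exists l, wcvg F u l.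
Proof.
move=> UF uM; have [t0 t0M] := filter_ex uM.
have ux x : \forall t \near F, `|u t x| <= M * `|x|.
  apply: filterS uM => t utM.
  by apply: le_trans (dual_norm_le (u t) x) _; rewrite ler_wpM2r.
have [l ul] := choice (fun x => bounded_ultra_cvg UF (ux x)).
have ll : linear (l : X -> R^o).
  move=> a x y.
  apply: (@cvg_unique _ _ (u t (a *: x + y) @[t --> F])) => //; first exact: ul.
  have -> : (fun t => u t (a *: x + y)) = (fun t => a *: (u t x : R^o) + u t y).
    by apply/funext => t; exact: dual_linear.
  by apply: cvgD; [apply: cvgZr|]; exact: ul.
have lM x : `|l x| <= M * `|x|.
  have /cvg_norm c := ul x.
  by apply: (cvgr_to_le c); exact: ux.
pose L : {linear X -> R^o} := HB.pack (l : X -> R^o) (GRing.isLinear.Build _ _ _ _ _ ll).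
have lc : continuous (l : X -> R^o).
  apply: (@bounded_linear_continuous R X R^o L).
  apply/linear_boundedP; near=> r => x /=.
  by apply: le_trans (lM x) _; rewrite ler_wpM2r.
have lP : (l : X -> R^o) \in @dual_pred R X by apply/dual_predP.
by exists (Dual lP).
Unshelve. all: by end_near. Qed.

Definition wlim T (F : set_system T) (u : T -> dual X) : dual X :=
  xget 0 [set l | wcvg F u l].

Lemma wlimP T (F : set_system T) (u : T -> dual X) (M : R) :
  UltraFilter F -> (\forall t \near F, `|u t| <= M) -> wcvg F u (wlim F u).
Proof. by move=> UF uM; have := xgetPex 0 (bounded_ultra_wcvg UF uM). Qed.

(** Closedness is only required for limits along the given filter, as this is
the only way in which new points are produced. *)
Definition wlim_closed T (F : set_system T) K :=
  forall u l, wcvg F u l -> (\forall t \near F, K (u t)) -> K l.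

Lemma wlim_closed_ball T (F : set_system T) : ProperFilter F ->
  wlim_closed F (@dual_ball R X).
Proof.
move=> FF u l ul uB; rewrite /dual_ball /= -[l]subr0.
by apply: (wcvg_norm_le FF ul); apply: filterS uB => t; rewrite subr0.
Qed.

Lemma wlim_closed_szlenk T (F : set_system T) (e : R) K : ProperFilter F ->
  wlim_closed F K -> wlim_closed F (szlenk_derivation e K).
Proof.
move=> FF cK u l ul uK; split.
  by apply: (cK u l ul); apply: filterS uK => t [].
move=> [V [oV dV] Vl].
have [t [[_ nVt] Vt]] := filter_ex (filterI uK (wcvg_open FF ul oV Vl)).
by apply: nVt; exists V.
Qed.

(** The mechanism that links jumps to the Szlenk index: a weak-star
neighbourhood of the limit also contains points of [K] at distance at least
[e] from it, so its trace on [K] has diameter at least [e]. *)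
Lemma szlenk_jump T (F : set_system T) (e : R) K u l : ProperFilter F ->
  wlim_closed F K -> wcvg F u l -> (\forall t \near F, K (u t)) ->
  (\forall t \near F, e <= `|u t - l|) -> szlenk_derivation e K l.
Proof.
move=> FF cK ul uK ue; have Kl := cK u l ul uK; split=> // -[V [oV dV] Vl].
have [t [[Kt et] Vt]] :=
  filter_ex (filterI (filterI uK ue) (wcvg_open FF ul oV Vl)).
move: dV; apply/negP; rewrite -leNgt.
apply: (@le_trans _ _ (`|u t - l|)%:E); first by rewrite lee_fin.
by apply: ereal_sup_ubound; exists (u t, l).
Qed.

Lemma wlim_closed_iter_szlenk T (F : set_system T) (es : seq R) :
  ProperFilter F ->
  wlim_closed F (foldl (fun K a => szlenk_derivation a K) (@dual_ball R X) es).
Proof.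
move=> FF; elim/last_ind: es => [|es e IH]; first exact: wlim_closed_ball.
by rewrite foldl_rcons; exact: wlim_closed_szlenk.
Qed.

End WeakStarLimits.

(** * Iterated ultrafilters *)

Section IteratedFilters.
Variable U : set_system nat.
Hypothesis UU : UltraFilter U.

(** A set belongs to [iterf j] when it contains the tuple (n_1, ..., n_j) for
[U]-almost all n_1, then [U]-almost all n_2, and so on.  The recursion is on
the last entry, because the limits below are taken in the last entry first. *)
Fixpoint iterf j : set_system (seq nat) := fun P =>
  if j is i.+1 then iterf i [set s | \forall n \near U, P (rcons s n)]
  else P [::].

(** The same for the entries n_1, m_1, n_2, m_2, ... in this order, so that
almost all pairs are interlaced when [U] is free. *)
Fixpoint iterf2 j : set_system (seq nat * seq nat) := fun P =>
  if j is i.+1 then iterf2 i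
    [set p | \forall n \near U, \forall m \near U, P (rcons p.1 n, rcons p.2 m)]
  else P ([::], [::]).

Lemma iterf_filter j : Filter (iterf j).
Proof.
elim: j => [|j IH]; first by split=> //= P Q PQ; exact: PQ.
split=> /= [|P Q iP iQ|P Q PQ].
- by apply: filterS filterT => s _; exact: filterT.
- by apply: filterS (filterI iP iQ) => s [Ps Qs]; exact: filterI.
- by apply: filterS => s; apply: filterS => n; exact: PQ.
Qed.

Lemma iterf2_filter j : Filter (iterf2 j).
Proof.
elim: j => [|j IH]; first by split=> //= P Q PQ; exact: PQ.
split=> /= [|P Q iP iQ|P Q PQ].
- by apply: filterS filterT => s _; apply: filterS filterT => n _; exact: filterT.
- apply: filterS (filterI iP iQ) => s [Ps Qs].
  by apply: filterS (filterI Ps Qs) => n [Pn Qn]; exact: filterI.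
- by apply: filterS => s; apply: filterS => n; apply: filterS => m; exact: PQ.
Qed.

#[local] Existing Instance iterf_filter.
#[local] Existing Instance iterf2_filter.

(** Being an ultrafilter is what makes every bounded function of a tuple, in
particular each jump below, converge along [iterf j]. *)
Lemma iterf_ultra j : UltraFilter (iterf j).
Proof.
elim: j => [|j IH]; apply: ultra_of_setVsetC.
- by split=> //; exact: iterf_filter.
- by move=> A; case: (EM (A [::])); [left|right].
- by split; [move=> /= /filter_ex[s] /filter_ex[]|exact: iterf_filter].
move=> A /=.
have [|AN] := in_ultra_setVsetC [set s | \forall n \near U, A (rcons s n)] IH.
  by left.
right; apply: filterS AN => s /= nA.
by have [//|] := in_ultra_setVsetC [set n | A (rcons s n)] UU.
Qed.

Lemma iterf_iterf2 j P : iterf j P -> iterf2 j [set p | P p.1].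
Proof.
elim: j P => [//|j IH] P /= /IH; apply: filterS => p /= ; apply: filterS => n Pn.
exact: nearW.
Qed.

End IteratedFilters.

(** * Extraction of an infinite set *)

Section Homogeneous.
Local Open Scope nat_scope.
Variable U : set_system nat.
Hypothesis UF : ProperFilter U.
Hypothesis U_free : forall N, \forall n \near U, N < n.
Variables (k : nat) (P : set (seq nat)).

(** The intermediate stages of [iterf], read from the front: the entries of [s]
are already fixed and the [r] remaining ones are generic. *)
Fixpoint later r : set (seq nat) := fun s =>
  if r is i.+1 then \forall n \near U, later i (rcons s n) else P s.

Lemma iterf_later j r : iterf U (j + r) P -> iterf U j (later r).
Proof. by elim: r j => [|r IH] j; [rewrite addn0|rewrite addnS => /(IH j.+1)]. Qed.

(** The invariant of the diagonal construction: every subsequence of the entries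
chosen so far can still be completed generically to an element of [P]. *)
Definition promising (L : seq nat) :=
  path ltn 0 L /\
  forall s, subseq s L -> size s <= k -> later (k - size s) s.

Lemma promising_nil : iterf U k P -> promising [::].
Proof.
move=> kP; split=> // s; rewrite subseq0 => /eqP -> _ /=; rewrite subn0.
exact: (@iterf_later 0 k kP).
Qed.

(** A new entry has to satisfy one [U]-almost sure condition for each of the
finitely many subsequences of [L]. *)
Lemma promising_rcons L : promising L -> exists m, promising (rcons L m).
Proof.
move=> [pL gL].
suff /filter_ex[m [Lm sm]] : \forall m \near U, last 0 L < m /\
    forall bs : (size L).-tuple bool, size (mask bs L) < k ->
      later (k - (size (mask bs L)).+1) (rcons (mask bs L) m).
  exists m; split; first by rewrite rcons_path pL.
  move=> s /subseqP[bs]; case/lastP: bs => [|bs b]; first by rewrite size_rcons.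
  rewrite !size_rcons => -[bsL] ->; rewrite mask_rcons//.
  case: b => /=; rewrite ?cats1 ?cats0 ?size_rcons => bsk.
    by have /eqP bsE := bsL; exact: (sm (Tuple bsE)).
  by apply: gL => //; apply: mask_subseq.
apply: filterI; first exact: U_free.
apply: filter_forall => bs.
have [bsk|] := ltnP (size (mask bs L)) k; last by move=> _; apply: nearW.
have := gL _ (mask_subseq bs L) (ltnW bsk).
by rewrite -(subnSK bsk) /=; apply: filterS.
Qed.

(** A Ramsey-type statement: the entries of [M] are chosen one by one with
[promising_rcons]. *)
Lemma homogeneous_subset : iterf U k P ->
  exists M : set nat, [/\ infinite_set M, M `<=` [set i | 0 < i] &
    forall s, path ltn 0 s -> size s = k -> (forall i, i \in s -> M i) -> P s].
Proof.
move=> kP.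
pose step L := rcons L (xget 0 [set m | promising (rcons L m)]).
pose L i := iter i step [::].
have gL i : promising (L i).
  elim: i => [|i IH]; first exact: promising_nil.
  by have /(xgetPex 0) := promising_rcons IH.
have LS i : L i.+1 = rcons (L i) (last 0 (L i.+1)) by rewrite last_rcons.
have Lmono i j x : i <= j -> x \in L i -> x \in L j.
  move=> /subnK <-; elim: (j - i) => // d IH /IH xL.
  by rewrite addSn LS mem_rcons inE xL orbT.
have Lge i : i <= last 0 (L i).
  elim: i => // i IH; have := (gL i.+1).1.
  by rewrite LS rcons_path last_rcons => /andP[_]; exact: leq_ltn_trans.
exists [set x | exists i, x \in L i]; split.
- move=> /finite_seqP[s Ms].
  pose N := \max_(x <- s) x.
  have : last 0 (L N.+1) \in s.
    suff : [set` s] (last 0 (L N.+1)) by [].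
    by rewrite -Ms; exists N.+1; rewrite LS mem_rcons last_rcons inE eqxx.
  move=> /(@leq_bigmax_seq _ _ xpredT id)/(_ isT)/(leq_trans (Lge _)).
  by rewrite ltnn.
- move=> x [i xL]; have := order_path_min ltn_trans (gL i).1.
  by move=> /allP/(_ _ xL).
- move=> s s0 sk sM.
  have [i si] : exists i, forall x, x \in s -> x \in L i.
    elim: s {s0 sk} sM => [|x s IH] sM; first by exists 0.
    have [i xi] := sM x (mem_head _ _).
    have [|j sj] := IH; first by move=> y ys; apply: sM; rewrite inE ys orbT.
    exists (maxn i j) => y; rewrite inE => /predU1P[->|/sj].
      exact: Lmono (leq_maxl _ _) xi.
    exact: Lmono (leq_maxr _ _).
  (* an increasing tuple with entries in [L i] is a subsequence of [L i] *)
  have sE : s = [seq x <- L i | x \in s].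
    apply: (irr_sorted_eq ltn_trans ltnn).
    - exact: path_sorted s0.
    - by apply: sorted_filter; [exact: ltn_trans|exact: path_sorted (gL i).1].
    - by move=> x; rewrite mem_filter; case: (boolP (x \in s)) => // /si ->.
  have := (gL i).2 s; rewrite sk leqnn subnn; apply => //.
  by rewrite sE; exact: filter_subseq.
Qed.

End Homogeneous.

Lemma free_ultrafilter :
  exists2 U : set_system nat, UltraFilter U & forall N, \forall n \near U, (N < n)%N.
Proof.
have [U [UU oU]] := ultraFilterLemma eventually_filter.
by exists U => // N; apply: oU; exists N.+1.
Qed.

(** * Interlaced sequences *)

Section Interlacing.
Local Open Scope nat_scope.

(** [interlaced] without the dependency on the length; strictly increasing
sequences of positive integers are represented by [path ltn 0]. *)
Definition interlacing (s t : seq nat) :=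
  [/\ size s = size t, forall i, i < size s -> nth 0 s i <= nth 0 t i &
      forall i, i.+1 < size s -> nth 0 t i <= nth 0 s i.+1].

Lemma interlacing_refl s : path ltn 0 s -> interlacing s s.
Proof.
move=> /path_sorted/(sortedP 0) s0; split=> // i ik.
exact/ltnW/s0.
Qed.

Lemma interlacing_rcons s t n m : interlacing s t -> last 0 t <= n -> n <= m ->
  interlacing (rcons s n) (rcons t m).
Proof.
move=> [st s_t t_s] tn nm; split; rewrite ?size_rcons ?st// => i.
  rewrite ltnS !nth_rcons st => it.
  have [lt|_] := ltnP i (size t); first by apply: s_t; rewrite st.
  by case: ifP.
rewrite ltnS !nth_rcons st => it; rewrite it.
have [lt|ge] := ltnP i.+1 (size t); first by apply: t_s; rewrite st.
have ti : i.+1 = size t by apply/eqP; rewrite eqn_leq it ge.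
rewrite ti eqxx; apply: leq_trans tn.
by rewrite -nth_last -ti.
Qed.

End Interlacing.

(** * Iterated weak-star limits of a Lipschitz map *)

Section IteratedLimits.
Context {R : realType} {X : normedModType R}.
Variable U : set_system nat.
Hypothesis UU : UltraFilter U.
Hypothesis U_free : forall N, \forall n \near U, (N < n)%N.
Variables (k : nat) (F : seq nat -> dual X).
Hypothesis F_lip : forall s t, path ltn 0%N s -> path ltn 0%N t ->
  interlacing s t -> size s = k -> `|F s - F t| <= 1.

(** On a sequence of length [k - r] this is the limit of [F] in its last [r]
entries. *)
Fixpoint iterlim r (s : seq nat) : dual X :=
  if r is i.+1 then wlim U (fun n => iterlim i (rcons s n)) else F s.

Definition lipschitz_level r := forall s t, path ltn 0%N s -> path ltn 0%N t ->
  interlacing s t -> (size s + r = k)%N -> `|iterlim r s - iterlim r t| <= 1.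

Lemma near_path s : path ltn 0%N s ->
  \forall n \near U, path ltn 0%N (rcons s n).
Proof.
by move=> s0; apply: filterS (U_free (last 0%N s)) => n sn; rewrite rcons_path s0.
Qed.

(** Two extensions of [s] by one entry are interlaced, so the Lipschitz bound
makes the sequence of extensions bounded, and its limit exists. *)
Lemma level_cvg r s : lipschitz_level r -> path ltn 0%N s ->
  (size s + r.+1 = k)%N ->
  wcvg U (fun n => iterlim r (rcons s n)) (iterlim r.+1 s).
Proof.
move=> rL s0 sk; pose n0 := (last 0 s).+1.
apply: (@wlimP _ _ _ _ _ (1 + `|iterlim r (rcons s n0)|)).
apply: filterS (U_free n0) => n n0n.
rewrite -[X in `|X|](subrK (iterlim r (rcons s n0))).
apply: le_trans (ler_normD _ _) _; rewrite lerD2r distrC; apply: rL.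
- by rewrite rcons_path s0 /n0 /= leqnn.
- by rewrite rcons_path s0 /= (ltn_trans _ n0n).
- by apply: interlacing_rcons (interlacing_refl s0) _ (ltnW n0n); rewrite leqW.
- by rewrite size_rcons addSnnS.
Qed.

(** Extend [s] by [n] and [t] by a larger [m]: the extensions are interlaced, and
lower semicontinuity passes the bound to the limit in [m], then in [n]. *)
Lemma lipschitz_levelP r : lipschitz_level r.
Proof.
elim: r => [s t s0 t0 st|r IH s t s0 t0 st sk].
  by rewrite addn0; exact: F_lip.
have tk : (size t + r.+1 = k)%N by case: st => <-.
have sL := level_cvg IH s0 sk; have tL := level_cvg IH t0 tk.
apply: (wcvg_norm_le _ sL).
apply: filterS (filterI (near_path s0) (U_free (last 0%N t))) => n [sn tn].
rewrite distrC; apply: (wcvg_norm_le _ tL).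
apply: filterS (filterI (near_path t0) (U_free n)) => m [tm nm].
rewrite distrC; apply: IH => //; last by rewrite size_rcons addSnnS.
by apply: interlacing_rcons => //; exact: ltnW.
Qed.

Lemma iterlim_cvg r s : path ltn 0%N s -> (size s + r.+1 = k)%N ->
  wcvg U (fun n => iterlim r (rcons s n)) (iterlim r.+1 s).
Proof. exact/level_cvg/lipschitz_levelP. Qed.

Definition increasing j : set (seq nat) := [set s | path ltn 0%N s /\ size s = j].

Lemma iterf_increasing j : iterf U j (increasing j).
Proof.
elim: j => //= j IH; have := iterf_filter UU j => ?.
apply: filterS IH => s [s0 sj].
by apply: filterS (near_path s0) => n sn; split=> //=; rewrite size_rcons sj.
Qed.

Lemma iterf2_interlacing j : iterf2 U j
  [set p | [/\ increasing j p.1, increasing j p.2 & interlacing p.1 p.2]].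
Proof.
elim: j => //= j IH; have := iterf2_filter UU j => ?.
apply: filterS IH => -[s t] /= [[s0 sj] [t0 tj] st].
apply: filterS (filterI (near_path s0) (U_free (last 0%N t))) => n [sn tn].
apply: filterS (filterI (near_path t0) (U_free n)) => m [tm nm].
split; rewrite /increasing /= ?size_rcons ?sj ?tj//.
by apply: interlacing_rcons => //; exact: ltnW.
Qed.

(** The distance between the limits before and after the last entry of [s] has
been sent to infinity. *)
Definition jump r (s : seq nat) : R :=
  `|iterlim r s - iterlim r.+1 (take (size s).-1 s)|.

Lemma jump_rcons r s n :
  jump r (rcons s n) = `|iterlim r (rcons s n) - iterlim r.+1 s|.
Proof. by rewrite /jump size_rcons /= -cats1 take_size_cat. Qed.

Lemma jump_le1 j r : (j + r.+1 = k)%N -> iterf U j.+1 [set s | jump r s <= 1].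
Proof.
move=> jk /=; have := iterf_filter UU j => ?.
apply: filterS (iterf_increasing j) => s [s0 sj].
have sk : (size s + r.+1 = k)%N by rewrite sj.
apply: filterS (filterI (near_path s0) (U_free (last 0%N s))) => n [sn ln] /=.
rewrite jump_rcons distrC; apply: (wcvg_norm_le _ (iterlim_cvg s0 sk)).
apply: filterS (filterI (near_path s0) (U_free n)) => m [sm nm].
rewrite distrC; apply: lipschitz_levelP => //.
  by apply: interlacing_rcons (interlacing_refl s0) _ _; exact: ltnW.
by rewrite size_rcons addSnnS.
Qed.

(** The number [a r] is half the limit [l] of the jumps of level [r].  The half
leaves room for jumps to be at least [a r] almost always if [0 < l]; if
[l = 0] the level is negligible and produces no derivation. *)
Lemma jump_size (d : R) : 0 < d -> exists a : nat -> R, forall j r, (j + r.+1 = k)%N ->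
  [/\ 0 <= a r, iterf U j.+1 [set s | jump r s <= 2 * a r + d] &
      0 < a r -> iterf U j.+1 [set s | a r <= jump r s]].
Proof.
move=> d0; suff /choice[a aP] : forall r, exists a, forall j, (j + r.+1 = k)%N ->
    [/\ 0 <= a, iterf U j.+1 [set s | jump r s <= 2 * a + d] &
        0 < a -> iterf U j.+1 [set s | a <= jump r s]].
  by exists a => j r; exact: aP.
move=> r; have [rk|kr] := ltnP r k; last first.
  by exists 0 => j jk; move: kr; rewrite -jk addnS ltnNge leq_addl.
have jk : ((k - r.+1) + r.+1 = k)%N by rewrite subnK.
have UJ := iterf_ultra UU (k - r.+1).+1.
have [|l jl] := @bounded_ultra_cvg _ _ _ (jump r) 1 UJ.
  by apply: filterS (jump_le1 jk) => s; rewrite normr_id.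
have l0 : 0 <= l.
  by apply: (cvgr_to_ge jl); apply: nearW => s; exact: normr_ge0.
exists (l / 2) => j jk'.
have -> : j = (k - r.+1)%N by rewrite -jk' addnK.
split.
- by rewrite divr_ge0.
- have -> : 2 * (l / 2) + d = l + d by field.
  by apply: (cvgr_le l jl); rewrite ltrDl.
- by move=> l20; apply: (cvgr_ge l jl); lra.
Qed.

(** Levels with [a r = 0] are skipped, since Szlenk derivations have positive
parameters. *)
Definition szlenk_levels (a : nat -> R) r : set (dual X) :=
  foldl (fun K e => szlenk_derivation e K) (@dual_ball R X)
    [seq e <- map a (iota 0 r) | 0 < e].

Lemma szlenk_levelsS a r : szlenk_levels a r.+1 =
  if 0 < a r then szlenk_derivation (a r) (szlenk_levels a r)
  else szlenk_levels a r.
Proof.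
rewrite /szlenk_levels -[in iota 0 r.+1]addn1 iotaD map_cat filter_cat foldl_cat.
by rewrite /= add0n; case: ifP.
Qed.

(** The heart of the proof.  From level [r] to level [r.+1] there are two limits:
the one in the last entry of [t] uses only that the derived set is closed, the
one in the last entry of [s] goes through [szlenk_jump]. *)
Lemma iterlim_szlenk_levels (a : nat -> R) :
  (forall j r, (j + r.+1 = k)%N -> 0 < a r ->
    iterf U j.+1 [set s | a r <= jump r s]) ->
  forall r j, (j + r = k)%N ->
    iterf2 U j [set p | szlenk_levels a r (iterlim r p.1 - iterlim r p.2)].
Proof.
move=> aJ; elim=> [|r IH] j jk; have := iterf2_filter UU j => ?.
  apply: filterS (iterf2_interlacing j) => -[s t] /= [[s0 sj] [t0 tj] st].
  by apply: (@lipschitz_levelP 0) => //; rewrite sj.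
have big : iterf2 U j [set p | 0 < a r ->
    \forall n \near U, a r <= `|iterlim r (rcons p.1 n) - iterlim r.+1 p.1|].
  have [ar|ar] := ltP 0 (a r); last by apply: filterS filterT => p _.
  have ajr : iterf U j [set s | \forall n \near U, a r <= jump r (rcons s n)].
    exact: aJ jk ar.
  apply: filterS (iterf_iterf2 UU ajr) => p /= pn _.
  by apply: filterS pn => n; rewrite jump_rcons.
have IHj : iterf2 U j [set p | \forall n \near U, \forall m \near U,
    szlenk_levels a r (iterlim r (rcons p.1 n) - iterlim r (rcons p.2 m))].
  by apply: (IH j.+1); rewrite addSnnS.
apply: filterS (filterI (filterI IHj big) (iterf2_interlacing j)).
move=> -[s t] /= [[Ks bs] [[s0 sj] [t0 tj] st]].
have sL := iterlim_cvg s0 (etrans (congr1 (addn^~ r.+1) sj) jk).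
have tL := iterlim_cvg t0 (etrans (congr1 (addn^~ r.+1) tj) jk).
have cK : wlim_closed U (szlenk_levels a r) by exact: wlim_closed_iter_szlenk.
have sK : \forall n \near U,
    szlenk_levels a r (iterlim r (rcons s n) - iterlim r.+1 t).
  by apply: filterS Ks => n; apply: cK; exact: wcvgBr.
have sB : wcvg U (fun n => iterlim r (rcons s n) - iterlim r.+1 t)
    (iterlim r.+1 s - iterlim r.+1 t) by exact: wcvgB.
rewrite szlenk_levelsS; case: ifP => ar; last exact: cK sB sK.
apply: szlenk_jump cK sB sK _ => //; apply: filterS (bs ar) => n.
by rewrite opprB addrA subrK.
Qed.

Lemma telescope_jumps (b : nat -> R) :
  (forall j r, (j + r.+1 = k)%N -> iterf U j.+1 [set s | jump r s <= b r]) ->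
  forall j r, (j + r = k)%N -> iterf U j
    [set s | `|iterlim r s - iterlim k [::]| <= \sum_(r <= i < k) b i].
Proof.
move=> bJ; elim=> [|j IH] r jk.
  by rewrite add0n in jk; rewrite /= jk subrr normr0 big_geq.
have jk' : (j + r.+1 = k)%N by rewrite -addSnnS.
have := iterf_filter UU j => ? /=.
have bj : iterf U j [set s | \forall n \near U, jump r (rcons s n) <= b r].
  exact: bJ jk'.
apply: filterS (filterI (IH _ jk') bj) => s [sr].
apply: filterS => n /=; rewrite jump_rcons => jn.
rewrite big_ltn; last by rewrite -jk' addnS ltnS leq_addl.
by rewrite -(subrKA (iterlim r.+1 s)) (le_trans (ler_normD _ _))// lerD.
Qed.

(** Summability enters here: the difference of [iterlim k [::]] with itself is in
the last derived set, which is therefore nonempty. *)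
Lemma interlacing_concentration (c : R) :
  (forall (n : nat) (e : n.-tuple R), (0 < n)%N ->
    (forall i, 0 < tnth e i) ->
    foldl (fun K a => szlenk_derivation a K) (@dual_ball R X) e !=set0 ->
      \sum_(i < n) tnth e i <= c) ->
  0 < c ->
  exists g : dual X, iterf U k [set s | `|F s - g| <= 2 * c + 1].
Proof.
move=> Xc c0; pose d : R := k.+1%:R^-1.
have [|a aP] := @jump_size d; first by rewrite invr_gt0.
have a0 r : (r < k)%N -> 0 <= a r.
  by move=> rk; have [] := aP (k - r.+1)%N r (subnK rk).
have aJ j r : (j + r.+1 = k)%N -> 0 < a r -> iterf U j.+1 [set s | a r <= jump r s].
  by move=> /aP[].
have sum_a : \sum_(0 <= i < k) a i <= c.
  pose es := [seq e <- map a (iota 0 k) | 0 < e].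
  have -> : \sum_(0 <= i < k) a i = \sum_(i < size es) tnth (in_tuple es) i.
    rewrite -(big_tuple _ _ (in_tuple es) xpredT idfun) big_filter big_map.
    rewrite /index_iota subn0 (bigID (fun i => 0 < a i))/= [X in _ + X]big_seq_cond.
    rewrite [X in _ + X]big1 ?addr0// => i; rewrite mem_iota add0n -leNgt.
    by move=> /andP[/a0 ai ai']; apply/eqP; rewrite eq_le ai ai'.
  have [es0|es0] := posnP (size es).
    rewrite big1 ?ltW// => i _; have := ltn_ord i.
    by rewrite [X in (_ < X)%N]es0.
  apply: Xc => // [i|].
    have : tnth (in_tuple es) i \in es by exact: mem_tnth.
    by rewrite mem_filter => /andP[].
  exists (iterlim k [::] - iterlim k [::]).
  exact: (iterlim_szlenk_levels aJ (add0n k)).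
(* each of the [k] jumps exceeds [2 * a r] by at most [d = 1 / (k + 1)], which
   accounts for the [+ 1] *)
exists (iterlim k [::]).
have := telescope_jumps (fun j r jk => let: And3 _ h _ := aP j r jk in h) (addn0 k).
have := iterf_filter UU k => ?; apply: filterS => s /le_trans; apply.
rewrite big_split/= -mulr_sumr lerD//; first by rewrite ler_pM2l.
rewrite big_const_nat subn0 iter_addr addr0 -[leLHS]mulr_natr mulrC.
by rewrite ler_pdivrMr// mul1r ler_nat.
Qed.

End IteratedLimits.

(** * Maps on the interlaced graph *)

Section KSubsetsAsSequences.
Variable k : nat.

Lemma ksubset_path (n : ksubset k) : path ltn 0%N (val (val n)).
Proof.
by rewrite (path_sortedE ltn_trans) andbC; exact: valP n.
Qed.

Lemma ksubset_of_path s : path ltn 0%N s -> size s = k ->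
  exists n : ksubset k, val (val n) = s.
Proof.
rewrite (path_sortedE ltn_trans) andbC => sP /eqP sk.
by exists (Sub (Tuple sk) sP).
Qed.

(** Total on sequences, so that the entries of a vertex can be appended and sent
to infinity one at a time; 0 is a default value. *)
Definition seq_extension (T : nmodType) (f : ksubset k -> T) (s : seq nat) : T :=
  oapp f 0 (obind insub (insub s : option (k.-tuple nat))).

Lemma seq_extensionE (T : nmodType) (f : ksubset k -> T) n :
  seq_extension f (val (val n)) = f n.
Proof. by rewrite /seq_extension valK /= valK. Qed.

Lemma ksubset_nthE (n : ksubset k) (i : 'I_k) : n i = nth 0%N (val (val n)) i.
Proof. by rewrite /ksubset_nth (tnth_nth 0%N). Qed.

Lemma interlacing_interlaced (n m : ksubset k) :
  interlacing (val (val n)) (val (val m)) -> interlaced n m.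
Proof.
rewrite /interlacing !size_tuple => -[_ nm mn]; apply/andP; split.
  by apply/forallP => i; rewrite !ksubset_nthE nm.
apply/forallP => i; apply/forallP => j; apply/implyP => /eqP ji.
by rewrite !ksubset_nthE ji mn// -ji.
Qed.

Lemma interlaced_dist_adjacent (n m : ksubset k) :
  interlaced_adjacent n m -> (interlaced_dist n m <= 1)%N.
Proof.
move=> nm; rewrite /interlaced_dist; case: ex_minnP => l _; apply.
by apply/asboolP; exists [:: m]; split=> //=; rewrite nm.
Qed.

Lemma eq_of_adjacent_eq T (f : ksubset k -> T) :
  (forall n m, interlaced_adjacent n m -> f n = f m) -> forall n m, f n = f m.
Proof.
move=> adj n m; have [l /asboolP[p [np <- _]]] := interlaced_connected n m.
by elim: p n np => //= q p IH n /andP[/adj -> /IH].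
Qed.

End KSubsetsAsSequences.

(** The Lipschitz condition is what makes the modulus at 1 a real number. *)
Lemma modulus_fin_num (R : realType) (Z : normedModType R) k (f : ksubset k -> Z) :
  interlaced_lipschitz f ->
  exists2 w : R, 0 <= w & modulus f 1 = w%:E /\
    forall n m, interlaced_adjacent n m -> `|f n - f m| <= w.
Proof.
move=> [L fL].
have [n0 _] := ksubset_of_path (iota_ltn_sorted 0 k.+1) (size_iota 1 k).
have m0 : (0 <= modulus f 1)%E.
  apply: ereal_sup_ubound; exists (n0, n0); last by rewrite /= subrr normr0.
  rewrite /= /interlaced_dist; case: ex_minnP => l _ lmin.
  have : (l <= 0)%N by apply: lmin; apply/asboolP; exists [::].
  by rewrite leqn0 => /eqP ->.
have mL : (modulus f 1 <= (`|L|)%:E)%E.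
  apply: ge_ereal_sup => _ [[n m] /= nm <-]; rewrite lee_fin.
  apply: le_trans (fL n m) _; apply: le_trans (ler_norm _) _.
  by rewrite normrM normr_nat ler_piMr.
have mfin : modulus f 1 \is a fin_num.
  by rewrite ge0_fin_numE// (le_lt_trans mL)// ltry.
exists (fine (modulus f 1)); first exact: fine_ge0.
rewrite fineK//; split=> // n m nm.
rewrite -lee_fin fineK//; apply: ereal_sup_ubound; exists (n, m) => //=.
by rewrite (ler_nat _ _ 1) interlaced_dist_adjacent.
Qed.

Theorem theorem4p1 (R : realType) (X : completeNormedModType R) :
  summable_szlenk_index X -> property_Q (dual X).
Proof.
move=> [c c0 Xc]; exists (2 * (2 * c + 1)); first lra.
move=> k f k0 /modulus_fin_num[w w0 [-> fw]].
(* rescaling is impossible when [w = 0]; then [f] is constant, as the graph is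
   connected *)
have [w00|wN0] := eqVneq w 0.
  exists [set i | (0 < i)%N]; split=> //.
    have -> : [set i | (0 < i)%N] = [set: nat] `\` [set 0%N].
      apply/seteqP; split=> i /=; first by rewrite lt0n => /eqP.
      by rewrite lt0n => -[_ /eqP].
    exact: infinite_setD infinite_nat (finite_set1 _).
  move=> n m _ _; rewrite (@eq_of_adjacent_eq _ _ f _ n m).
    by rewrite subrr normr0 w00 mule0.
  move=> {}n {}m /fw; rewrite w00 normr_le0 subr_eq0 => /eqP //.
have wgt0 : 0 < w by rewrite lt_neqAle eq_sym wN0.
have [U UU Ufree] := free_ultrafilter.
pose F := seq_extension (fun n => w^-1 *: f n).
have F_lip s t : path ltn 0%N s -> path ltn 0%N t -> interlacing s t ->
    size s = k -> `|F s - F t| <= 1.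
  move=> s0 t0 st sk; have tk : size t = k by case: st => <-.
  have [n ns] := ksubset_of_path s0 sk; have [m mt] := ksubset_of_path t0 tk.
  rewrite -ns -mt in st *; rewrite /F !seq_extensionE -scalerBr normrZ.
  rewrite normfV gtr0_norm// ler_pdivrMl// mulr1.
  have [->|nm] := eqVneq n m; first by rewrite subrr normr0.
  by apply: fw; rewrite /interlaced_adjacent nm interlacing_interlaced.
have [g /homogeneous_subset[//|M [Minf Mpos MP]]] :=
  interlacing_concentration UU Ufree F_lip Xc c0.
exists M; split=> // n m nM mM.
have Mg q : ksubsets_of M q -> `|f q - w *: g| <= w * (2 * c + 1).
  move=> qM; have := MP (val (val q)) (ksubset_path q) (size_tuple _).
  have qM' i : i \in val (val q) -> M i.
    by move=> /tnthP[j ->]; exact: qM.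
  move=> /(_ qM') /=; rewrite /F seq_extensionE.
  rewrite -(ler_pM2l wgt0) -[X in X * `|_|]gtr0_norm// -normrZ scalerBr.
  by rewrite scalerA divff// scale1r.
rewrite -EFinM lee_fin -(subrKA (w *: g)) (le_trans (ler_normD _ _))//.
have := Mg _ nM; have := Mg _ mM; rewrite distrC; lra.
Qed.
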